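(* Let $\mathcal{H}$ be a Hilbert space and $(\Omega,\mu)$ a measure space with positive measure $\mu$. Let $F$ and $G$ be two continuous Riesz bases for $\mathcal{H}$ with respect to $(\Omega,\mu)$, and let $S_G$ be the continuous frame operator of $G$. Then there exists an invertible operator $\Theta\in L(\mathcal{H})$ such that $G=S_G\Theta^*F$.
   Context: $L(\mathcal{H})$ denotes the bounded linear operators on $\mathcal{H}$. A mapping $F:\Omega\to\mathcal{H}$ is weakly measurable if $\omega\mapsto\langle f,F(\omega)\rangle$ is measurable for every $f\in\mathcal{H}$. A weakly measurable $F$ is a Bessel mapping if there is $B<\infty$ with $\int_\Omega|\langle f,F(\omega)\rangle|^2d\mu(\omega)\le B\|f\|^2$ for all $f\in\mathcal{H}$; it is a continuous frame if moreover there is $A>0$ with $A\|f\|^2\le\int_\Omega|\langle f,F(\omega)\rangle|^2d\mu(\omega)$ for all $f\in\mathcal{H}$. Vector-valued integrals $\int_\Omega\varphi(\omega)F(\omega)d\mu(\omega)$ are weak integrals: the vector $v$ with $\langle v,f\rangle=\int_\Omega\varphi(\omega)\langle F(\omega),f\rangle d\mu(\omega)$ for all $f\in\mathcal{H}$. $L^2(\Omega,\mathcal{H})$ denotes the set of all mappings $F:\Omega\to\mathcal{H}$ such that for every $f\in\mathcal{H}$ the function $\omega\mapsto\langle f,F(\omega)\rangle$, defined almost everywhere on $\Omega$, belongs to $L^2(\Omega,\mu)$. A Bessel mapping $F$ is $\mu$-complete if $\{\int_\Omega\varphi(\omega)F(\omega)d\mu(\omega):\varphi\in L^2(\Omega,\mu)\}$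 is dense in $\mathcal{H}$. A mapping $F\in L^2(\Omega,\mathcal{H})$ is a continuous Riesz basis for $\mathcal{H}$ with respect to $(\Omega,\mu)$ if it is $\mu$-complete and there are constants $A,B>0$ such that $$A\Big(\int_{\Omega_1}|\phi(\omega)|^2d\mu(\omega)\Big)^{1/2}\le\Big\|\int_{\Omega_1}\phi(\omega)F(\omega)d\mu(\omega)\Big\|\le B\Big(\int_{\Omega_1}|\phi(\omega)|^2d\mu(\omega)\Big)^{1/2}$$ for every $\phi\in L^2(\Omega,\mu)$ and every measurable $\Omega_1\subseteq\Omega$ with $\mu(\Omega_1)<\infty$. Every continuous Riesz basis is a continuous frame. The continuous frame operator of a continuous frame $G$ is the bounded positive invertible operator $S_G$ on $\mathcal{H}$ defined by $\langle S_Gf,g\rangle=\int_\Omega\langle f,G(\omega)\rangle\langle G(\omega),g\rangle d\mu(\omega)$ for $f,g\in\mathcal{H}$. For an operator $U$ on $\mathcal{H}$, $UF$ denotes the mapping $\omega\mapsto UF(\omega)$.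
   Formalization: The equality G = S_GΘ*F is proved weakly almost everywhere: for each f, ⟨f,G(ω)⟩ = ⟨f,S_GΘ*F(ω)⟩ for almost every ω, the null set possibly depending on f; equality at every ω is false (change F on a null set). *)

(* Defs.v *)
From HB Require Import structures.
From mathcomp Require Import all_boot all_order all_algebra sesquilinear.
From mathcomp Require Export complex.
From mathcomp Require Import all_classical all_reals all_analysis.

Set Implicit Arguments.
Unset Strict Implicit.
Unset Printing Implicit Defensive.

Import Order.TTheory GRing.Theory Num.Theory.
Import numFieldNormedType.Exports.

Local Open Scope classical_set_scope.
Local Open Scope ring_scope.
Local Open Scope complex_scope.

(* A complex Hilbert space is a complete normed space [H] over [R[i]] together
   with a positive definite Hermitian form [dot], linear in its first argument,
   which induces the norm, hence the topology, of [H]. *)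
Definition induces_norm (R : realType) (H : completeNormedModType R[i])
    (dot : {dot H for @Num.conj R[i]}) : Prop :=
  forall x : H, `|x| ^+ 2 = dot x x.

Section ComplexIntegral.
Context (d : measure_display) (T : measurableType d) (R : realType).
Variable mu : {measure set T -> \bar R}.
Implicit Types (D : set T) (phi : T -> R[i]).

Definition cmeasurable_fun phi : Prop :=
  measurable_fun setT (fun w => complex.Re (phi w)) /\
  measurable_fun setT (fun w => complex.Im (phi w)).

Definition cintegrable D phi : Prop :=
  mu.-integrable D (fun w => (complex.Re (phi w))%:E) /\
  mu.-integrable D (fun w => (complex.Im (phi w))%:E).

Definition cintegral D phi : R[i] :=
  (\int[mu]_(w in D) complex.Re (phi w)) +i*
  (\int[mu]_(w in D) complex.Im (phi w)).

Definition square_integrable phi : Prop :=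
  cmeasurable_fun phi /\
  (\int[mu]_w ((Normc.normc (phi w)) ^+ 2)%:E < +oo)%E.

Definition L2norm D phi : R :=
  Num.sqrt (\int[mu]_(w in D) (Normc.normc (phi w)) ^+ 2).

End ComplexIntegral.

Section ContinuousRieszBases.
Context (d : measure_display) (T : measurableType d) (R : realType).
Variable mu : {measure set T -> \bar R}.
Context (H : completeNormedModType R[i]).
Variable dot : {dot H for @Num.conj R[i]}.
Implicit Types (D : set T) (phi : T -> R[i]) (F G : T -> H) (f g v : H).

Definition is_weak_integral D phi F v : Prop :=
  forall f, cintegrable mu D (fun w => phi w * dot (F w) f) /\
            dot v f = cintegral mu D (fun w => phi w * dot (F w) f).

(* The vector is unique since [dot] is definite; the value is [0] when there is
   no such vector, which cannot happen for [phi] in L^2 and [F] in [L2H]. *)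
Definition weak_integral D phi F : H := xget 0 (is_weak_integral D phi F).

Definition L2H F : Prop :=
  forall f, square_integrable mu (fun w => dot f (F w)).

Definition mu_complete F : Prop :=
  dense [set weak_integral setT phi F | phi in square_integrable mu].

Definition continuous_riesz_basis F : Prop :=
  [/\ L2H F, mu_complete F &
      exists A B : R, [/\ 0 < A, 0 < B &
        forall phi D, square_integrable mu phi -> measurable D ->
          (mu D < +oo)%E ->
          (A * L2norm mu D phi)%:C <= `|weak_integral D phi F|
                                   <= (B * L2norm mu D phi)%:C]].

(* <frame_operator G f, g> is the integral of <f, G w> <G w, g>. *)
Definition frame_operator G : H -> H :=
  fun f => weak_integral setT (fun w => dot f (G w)) G.

Definition is_adjoint (U Us : H -> H) : Prop :=
  forall f g, dot (U f) g = dot f (Us g).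

(* Elements of L^2(Omega, H) are determined by the classes of the functions
   <f, F(.)> in L^2(Omega, mu). For non-separable [H] the exceptional null set
   may depend on [f]. *)
Definition weakly_ae_eq F G : Prop :=
  forall f, {ae mu, forall w, dot f (F w) = dot f (G w)}.

End ContinuousRieszBases.

(* Invertibility in the algebra of bounded operators; for linear maps between
   normed spaces, continuous is the same as bounded. *)
Definition invertible_operator (K : numFieldType) (H : normedModType K)
    (U : {linear H -> H}) : Prop :=
  continuous U /\
  exists V : {linear H -> H}, [/\ continuous V, cancel U V & cancel V U].

(* Main.v *)
(* Write T_F for the synthesis map [phi |-> \int phi F] from L^2(mu) to H, so that
   T_F^* is the analysis map [f |-> <f, F(.)>] and S_F = T_F T_F^*.  The Riesz
   bounds make T_F bounded and bounded below; with the density of its range, T_F^*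
   is bounded below as well, so S_F is coercive, hence invertible.  Since T_F is
   injective, T_F^* S_F^-1 T_F = 1 in L^2(mu).  Hence
   Theta := S_F^-1 T_F T_G^* S_G^-1 has inverse T_G T_F^*, and
   S_G Theta^* = T_G T_F^* S_F^-1, which gives, for almost all w,
   <f, S_G Theta^* F(w)> = (T_F^* S_F^-1 T_F T_G^* f)(w) = <f, G(w)>. *)

Require Import Defs.
From HB Require Import structures.
From mathcomp Require Import all_boot all_order all_algebra sesquilinear.
From mathcomp Require Import all_classical all_reals all_analysis.
From mathcomp Require Import measurable_realfun ring lra.

Set Implicit Arguments.
Unset Strict Implicit.
Unset Printing Implicit Defensive.

Import Order.TTheory GRing.Theory Num.Theory.
Import numFieldNormedType.Exports.
Local Open Scope classical_set_scope.
Local Open Scope ring_scope.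

(** * Discriminants, complex arithmetic and a squeeze criterion *)

(** Common core of the Cauchy-Schwarz inequalities in [H] and in L^2. At (b, c) the form equals b
    (ab - c^2), which settles the case b > 0. *)
Lemma sqr_le_mul_of_quadratic_ge0 (R : realFieldType) (a b c : R) :
  (forall x y, 0 <= x ^+ 2 * a - 2 * (x * y * c) + y ^+ 2 * b) -> c ^+ 2 <= a * b.
Proof.
move=> h; have b0 : 0 <= b by have := h 0 1; rewrite expr0n/= !mul0r expr1n; lra.
have [b_gt0|b_le0] := ltP 0 b.
  have := h b c; rewrite [X in 0 <= X](_ : _ = b * (a * b - c ^+ 2)); last by ring.
  by rewrite pmulr_rge0// subr_ge0.
have bE : b = 0 by apply/eqP; rewrite eq_le b_le0.
have [->|c0] := eqVneq c 0; first by rewrite bE expr0n/= mulr0.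
(* With b = 0 the form is affine in y, and this y gives it the value -1. *)
have := h 1 ((a + 1) / (2 * c)); rewrite bE mulr0 addr0 expr1n mul1r.
rewrite [X in 0 <= X](_ : _ = -1) ?oppr_ge0 ?ler10//.
by field.
Qed.

Lemma cReD (R : realType) (z w : R[i]) :
  complex.Re (z + w) = complex.Re z + complex.Re w.
Proof. by case: z => ? ?; case: w. Qed.

Lemma cReB (R : realType) (z w : R[i]) :
  complex.Re (z - w) = complex.Re z - complex.Re w.
Proof. by case: z => ? ?; case: w. Qed.

Lemma cImD (R : realType) (z w : R[i]) :
  complex.Im (z + w) = complex.Im z + complex.Im w.
Proof. by case: z => ? ?; case: w. Qed.

Lemma cImB (R : realType) (z w : R[i]) :
  complex.Im (z - w) = complex.Im z - complex.Im w.
Proof. by case: z => ? ?; case: w. Qed.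

Lemma cReM (R : realType) (z w : R[i]) :
  complex.Re (z * w) =
  complex.Re z * complex.Re w - complex.Im z * complex.Im w.
Proof. by case: z => ? ?; case: w. Qed.

Lemma cImM (R : realType) (z w : R[i]) :
  complex.Im (z * w) =
  complex.Re z * complex.Im w + complex.Im z * complex.Re w.
Proof. by case: z => ? ?; case: w. Qed.

Lemma cReJ (R : realType) (z : R[i]) : complex.Re (z^*)%C = complex.Re z.
Proof. by case: z. Qed.

Lemma cImJ (R : realType) (z : R[i]) : complex.Im (z^*)%C = - complex.Im z.
Proof. by case: z. Qed.

Lemma cvg_dist_squeeze (R : realType) (u e : nat -> R) (l : R) :
  (forall n, `|u n - l| <= e n) -> e @ \oo --> 0 -> u @ \oo --> l.
Proof.
move=> ue /cvgrPdist_lt e0; apply/cvgrPdist_lt => eps /e0.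
apply: filterS => n; rewrite sub0r normrN distrC.
exact/le_lt_trans/(le_trans (ue n))/ler_norm.
Qed.

(** * The real inner product space underlying [H] *)

Section RealInnerProduct.
Context (R : realType) (H : completeNormedModType R[i]).
Variable dot : {dot H for @Num.conj R[i]}.
Hypothesis Hdot : induces_norm dot.
Implicit Types (x y z : H) (a : R[i]) (t : R).

(** The norm of [H] takes its values in [R[i]]; estimates and limits are carried out in [R]
    instead. *)
Definition rnorm x : R := complex.Re `|x|.

Definition rdot x y : R := complex.Re (dot x y).

Lemma rnormE x : `|x| = (rnorm x)%:C%C.
Proof. by rewrite /rnorm RRe_real// normr_real. Qed.

Lemma rnorm_ge0 x : 0 <= rnorm x.
Proof. by rewrite -ler0c -rnormE. Qed.

Lemma rnorm0 : rnorm 0 = 0.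
Proof. by rewrite /rnorm normr0. Qed.

Lemma rnorm_eq0 x : rnorm x = 0 -> x = 0.
Proof. by move=> x0; apply/eqP; rewrite -normr_eq0 rnormE x0. Qed.

Lemma rnormZ t x : rnorm (t%:C%C *: x) = `|t| * rnorm x.
Proof.
apply: (@complexI R); rewrite -rnormE normrZ rnormE rmorphM/=.
by congr (_ * _); rewrite normc_def /= expr0n addr0 sqrtr_sqr.
Qed.

Lemma rnormB x y : rnorm (x - y) = rnorm (y - x).
Proof. by rewrite /rnorm distrC. Qed.

Lemma ler_rnormD x y : rnorm (x + y) <= rnorm x + rnorm y.
Proof. by rewrite -lecR rmorphD/= -!rnormE ler_normD. Qed.

Lemma dotC x y : dot x y = ((dot y x)^*)%C.
Proof. rewrite hermC/=. rewrite expr0 mul1r. by []. Qed.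

Lemma dotZl a x y : dot (a *: x) y = a * dot x y.
Proof. exact: linearZl_LR. Qed.

Lemma dotDl x y z : dot (x + y) z = dot x z + dot y z.
Proof. exact: linearDl. Qed.

Lemma dotBl x y z : dot (x - y) z = dot x z - dot y z.
Proof. exact: linearBl. Qed.

Lemma rdotC x y : rdot x y = rdot y x.
Proof. by rewrite /rdot dotC; case: (dot y x). Qed.

Lemma rdotDl x y z : rdot (x + y) z = rdot x z + rdot y z.
Proof. by rewrite /rdot dotDl cReD. Qed.

Lemma rdotBl x y z : rdot (x - y) z = rdot x z - rdot y z.
Proof. by rewrite /rdot dotBl cReB. Qed.

Lemma rdotBr x y z : rdot x (y - z) = rdot x y - rdot x z.
Proof. by rewrite ![rdot x _]rdotC rdotBl. Qed.

Lemma rdotZl a x y : rdot (a *: x) y = rdot x ((a^*)%C *: y).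
Proof.
by rewrite /rdot (dotC x (_ *: _)) !dotZl (dotC x y) !(cReM, cReJ, cImJ); ring.
Qed.

Lemma rdotZrl t x y : rdot (t%:C%C *: x) y = t * rdot x y.
Proof.
by rewrite /rdot dotZl cReM mul0r subr0.
Qed.

(** By conjugate linearity on the right, <x, iy> = -i <x, y>. Hence [rdot] determines [dot], and
    identities need to be checked on real parts only. *)
Lemma Im_dot x y : complex.Im (dot x y) = rdot x ('i%C *: y).
Proof.
by rewrite /rdot (dotC x (_ *: _)) dotZl (dotC x y) !(cReM, cReJ, cImJ)/=; ring.
Qed.

Lemma dot_eq x y x' y' : dot x y = dot x' y' <->
  rdot x y = rdot x' y' /\ rdot x ('i%C *: y) = rdot x' ('i%C *: y').
Proof.
rewrite -!Im_dot /rdot; case: (dot x y) (dot x' y') => ? ? [? ?] /=.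
by split=> [[-> ->]//|[-> ->]].
Qed.

(** The imaginary part is the real part at iy: the factor i moves to the left as its conjugate,
    passes through [U] by complex linearity, and moves back to the right. *)
Lemma rdot_adjoint (U Us : H -> H) : linear U ->
  (forall x y, rdot (U x) y = rdot x (Us y)) -> is_adjoint dot U Us.
Proof.
move=> linU h x y; apply/dot_eq; split; first exact: h.
have U0 : U 0 = 0.
  by have := linU (-1) 0 0; rewrite scaler0 addr0 scaleN1r addNr.
have E (z u : H) : rdot z ('i%C *: u) = rdot (('i^*)%C *: z) u.
  by rewrite rdotZl conjcK.
by rewrite !E -h -[_ *: x]addr0 linU U0 addr0.
Qed.

Lemma rdotxx x : rdot x x = rnorm x ^+ 2.
Proof. by rewrite /rdot -Hdot rnormE -rmorphXn. Qed.

Lemma rdot_ext x y : (forall z, rdot x z = rdot y z) -> x = y.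
Proof.
move=> xy; apply/eqP; rewrite -subr_eq0; apply/eqP/rnorm_eq0/eqP.
by rewrite -sqrf_eq0 -rdotxx rdotBl xy subrr.
Qed.

Lemma rnorm_sqrB x y :
  rnorm (x - y) ^+ 2 = rnorm x ^+ 2 - 2 * rdot x y + rnorm y ^+ 2.
Proof. by rewrite -!rdotxx rdotBl !rdotBr (rdotC y x); ring. Qed.

Lemma rdot_sqr_le x y : rdot x y ^+ 2 <= rnorm x ^+ 2 * rnorm y ^+ 2.
Proof.
apply: sqr_le_mul_of_quadratic_ge0 => s t.
have := sqr_ge0 (rnorm (s%:C%C *: x - t%:C%C *: y)).
by rewrite rnorm_sqrB !rnormZ !exprMn !real_normK ?num_real//
  rdotZrl rdotC rdotZrl rdotC !mulrA.
Qed.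

Lemma rdot_norm_le x y : `|rdot x y| <= rnorm x * rnorm y.
Proof.
rewrite -ler_sqr ?nnegrE ?mulr_ge0 ?rnorm_ge0//.
by rewrite real_normK ?num_real// exprMn rdot_sqr_le.
Qed.

Lemma rdot_le x y : rdot x y <= rnorm x * rnorm y.
Proof. exact: le_trans (ler_norm _) (rdot_norm_le x y). Qed.

(** Completeness with an explicit modulus, applied to the truncated weak integrals and to the
    iterates of a contraction. *)
Lemma rnorm_complete (v : nat -> H) (e : nat -> R) :
  (forall n m, (n <= m)%N -> rnorm (v m - v n) <= e n) -> e @ \oo --> 0 ->
  exists l, (fun n => rnorm (v n - l)) @ \oo --> 0.
Proof.
move=> ve e0.
have cv : cvgn v.
  apply/cauchy_cvgP/cauchy_ballP => eps eps0; near_simpl.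
  (* Radii of balls in [H] lie in [R[i]]; being positive, they are real. *)
  have epsE : (complex.Re eps)%:C%C = eps by rewrite RRe_real// gtr0_real.
  have r0 : 0 < complex.Re eps by rewrite -ltcR epsE.
  have : \forall n \near \oo, `|0 - e n| < complex.Re eps / 2.
    by move/cvgrPdist_lt : e0; apply; rewrite divr_gt0.
  case=> k _ /= hk.
  have d n : (k <= n)%N -> rnorm (v n - v k) < complex.Re eps / 2.
    move=> kn; apply: le_lt_trans (ve _ _ kn) _.
    by have := hk _ (leqnn k); rewrite sub0r normrN; apply: le_lt_trans (ler_norm _).
  exists ([set n | k <= n]%N, [set n | k <= n]%N); first by split; exists k.
  move=> [n m] [/= kn km]; rewrite -ball_normE /= -epsE rnormE ltcR.
  rewrite (_ : v n - v m = (v n - v k) + (v k - v m)); last by rewrite addrA subrK.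
  apply: le_lt_trans (ler_rnormD _ _) _.
  by rewrite [ltRHS]splitr ltrD ?d// rnormB d.
exists (limn v); apply/cvgrPdist_lt => eps eps0.
have epsC : 0 < eps%:C%C :> R[i] by rewrite ltcR.
move/cvgrPdist_lt : cv => /(_ _ epsC); apply: filterS => n.
by rewrite rnormE ltcR sub0r normrN ger0_norm ?rnorm_ge0// rnormB.
Qed.

Lemma cvg_rnorm (u : nat -> H) x :
  rnorm (u n - x) @[n --> \oo] --> 0 -> rnorm (u n) @[n --> \oo] --> rnorm x.
Proof.
apply: cvg_dist_squeeze => n; rewrite ler_norml.
have := ler_rnormD (u n - x) x; have := ler_rnormD (x - u n) (u n).
by rewrite !subrK (rnormB x) => *; apply/andP; split; lra.
Qed.

Lemma cvg_rdotl (u : nat -> H) x y :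
  rnorm (u n - x) @[n --> \oo] --> 0 -> rdot (u n) y @[n --> \oo] --> rdot x y.
Proof.
move=> ux; apply: (@cvg_dist_squeeze _ _ (fun n => rnorm (u n - x) * rnorm y)).
  by move=> n; rewrite -rdotBl rdot_norm_le.
by rewrite -(mul0r (rnorm y)); apply: cvgMl.
Qed.

Lemma linear_rnorm_bounded_continuous (U : {linear H -> H}) (C : R) :
  (forall x, rnorm (U x) <= C * rnorm x) -> continuous U.
Proof.
move=> UC; apply/linear_bounded_continuous/bounded_funP => r.
exists ((`|C| * complex.Re r)%:C)%C => x xr.
have r0 : 0 <= r := le_trans (normr_ge0 _) xr.
rewrite rnormE lecR (le_trans (UC x))//.
rewrite (le_trans (ler_wpM2r (rnorm_ge0 _) (ler_norm C)))// ler_wpM2l//.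
by rewrite -lecR -rnormE RRe_real// ger0_real.
Qed.

End RealInnerProduct.

(** * Square-integrable functions and their truncations *)

Lemma normc_sqr (R : realType) (z : R[i]) :
  Normc.normc z ^+ 2 = complex.Re (z * (z^*)%C).
Proof.
by case: z => a b /=; rewrite sqr_sqrtr ?addr_ge0 ?sqr_ge0//; ring.
Qed.

Lemma Re_mulJC (R : realType) (z w : R[i]) :
  complex.Re (z * (w^*)%C) = complex.Re (w * (z^*)%C).
Proof. by rewrite !(cReM, cReJ, cImJ); ring. Qed.

Lemma Re_mulJ_ge0 (R : realType) (z : R[i]) : 0 <= complex.Re (z * (z^*)%C).
Proof. by rewrite -normc_sqr sqr_ge0. Qed.

Lemma Re_mulJ_eq0 (R : realType) (z : R[i]) :
  complex.Re (z * (z^*)%C) = 0 -> z = 0.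
Proof. by rewrite -normc_sqr => /eqP; rewrite sqrf_eq0 => /eqP/Normc.eq0_normc. Qed.

Section SquareIntegrable.
Context (d : measure_display) (T : measurableType d) (R : realType).
Variable mu : {measure set T -> \bar R}.
Implicit Types (D : set T) (phi psi chi : T -> R[i]) (a : R[i]) (s t : R).

(** The real part of the L^2 inner product over [D], the counterpart of [rdot]. *)
Definition rip D phi psi : R :=
  \int[mu]_(w in D) complex.Re (phi w * ((psi w)^*)%C).

Lemma L2normE D phi : L2norm mu D phi = Num.sqrt (rip D phi phi).
Proof. by congr Num.sqrt; apply: eq_Rintegral => w _; rewrite normc_sqr. Qed.

Lemma rip_ge0 D phi : 0 <= rip D phi phi.
Proof. by apply: Rintegral_ge0 => w _; exact: Re_mulJ_ge0. Qed.

Lemma ripC D phi psi : rip D phi psi = rip D psi phi.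
Proof. by apply: eq_Rintegral => w _; rewrite Re_mulJC. Qed.

Lemma L2norm_ge0 D phi : 0 <= L2norm mu D phi.
Proof. exact: sqrtr_ge0. Qed.

Lemma measurable_Re_mulJ phi psi :
  cmeasurable_fun phi -> cmeasurable_fun psi ->
  measurable_fun setT (fun w => complex.Re (phi w * ((psi w)^*)%C)).
Proof.
move=> [mr mi] [nr ni]; under eq_fun do rewrite !(cReM, cReJ, cImJ) mulrN opprK.
by apply: measurable_funD; apply: measurable_funM.
Qed.

Lemma square_integrableP phi : square_integrable mu phi <->
  cmeasurable_fun phi /\
  mu.-integrable setT (fun w => (complex.Re (phi w * ((phi w)^*)%C))%:E).
Proof.
have E : (\int[mu]_w `|(complex.Re (phi w * ((phi w)^*)%C))%:E| =
          \int[mu]_w ((Normc.normc (phi w)) ^+ 2)%:E)%E.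
  by apply: eq_integral => w _; rewrite gee0_abs ?lee_fin ?Re_mulJ_ge0// normc_sqr.
split=> [[mphi foo]|[mphi /integrableP[_ foo]]]; split=> //; last by rewrite -E.
apply/integrableP; split; last by rewrite E.
exact/measurable_EFinP/measurable_Re_mulJ.
Qed.

(** The integrand is dominated by |phi|^2 + |psi|^2. *)
Lemma integrable_Re_mulJ phi psi D :
  square_integrable mu phi -> square_integrable mu psi -> measurable D ->
  mu.-integrable D (fun w => (complex.Re (phi w * ((psi w)^*)%C))%:E).
Proof.
move=> /square_integrableP[mphi iphi] /square_integrableP[mpsi ipsi] mD.
apply: (@integrableS _ _ _ _ setT) => //.
apply: (le_integrable _ _ _ (integrableD _ iphi ipsi)) => //.
  exact/measurable_EFinP/measurable_Re_mulJ.
move=> w _ /=; rewrite lee_fin [leRHS]ger0_norm ?addr_ge0 ?Re_mulJ_ge0//.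
rewrite !(cReM, cReJ, cImJ) !mulrN !opprK ler_norml.
move: (complex.Re _) (complex.Im _) (complex.Re _) (complex.Im _) => a b c e.
have := sqr_ge0 (a + c); have := sqr_ge0 (b + e).
have := sqr_ge0 (a - c); have := sqr_ge0 (b - e).
have := sqr_ge0 a; have := sqr_ge0 b; have := sqr_ge0 c; have := sqr_ge0 e.
by rewrite !sqrrD sqrrN !mulrN !expr2 => *; apply/andP; split; lra.
Qed.

Lemma square_integrable0 : square_integrable mu (fun=> 0).
Proof.
split; first by split; exact: measurable_cst.
by under eq_integral do rewrite Normc.normc0 expr0n; rewrite integral0 ltry.
Qed.

Lemma square_integrable_lin a phi psi :
  square_integrable mu phi -> square_integrable mu psi ->
  square_integrable mu (fun w => a * phi w + psi w).
Proof.
move=> p q; have := integrable_Re_mulJ p q measurableT.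
move: p q => /square_integrableP[[mr mi] iphi] /square_integrableP[[nr ni] ipsi].
have lin (u v u' v' : T -> R) (b e : R) : measurable_fun setT u ->
    measurable_fun setT v -> measurable_fun setT u' ->
    v' =1 (fun w => b * u w + e * v w + u' w) -> measurable_fun setT v'.
  move=> mu_ mv mu' E; rewrite (funext E).
  by apply: measurable_funD => //; apply: measurable_funD; apply: measurable_funM.
have m : cmeasurable_fun (fun w => a * phi w + psi w).
  split.
    apply: (lin _ _ _ _ (complex.Re a) (- complex.Im a) mr mi nr) => w.
    by rewrite cReD cReM mulNr.
  apply: (lin _ _ _ _ (complex.Re a) (complex.Im a) mi mr ni) => w.
  by rewrite cImD cImM.
move=> _; apply/square_integrableP; split=> //.
have i2 := integrableD measurableT (integrableZl measurableT
  (2 * complex.Re (a * (a^*)%C)) iphi) (integrableZl measurableT 2 ipsi).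
apply: (le_integrable _ _ _ i2) => //.
  exact/measurable_EFinP/measurable_Re_mulJ.
move=> w _ /=; rewrite lee_fin [leLHS]ger0_norm ?Re_mulJ_ge0//.
rewrite ger0_norm ?addr_ge0 ?mulr_ge0 ?Re_mulJ_ge0//.
rewrite !(cReD, cImD, cReM, cImM, cReJ, cImJ).
move: (complex.Re a) (complex.Im a) (complex.Re (phi w)) (complex.Im (phi w))
  (complex.Re (psi w)) (complex.Im (psi w)) => x y p q r s.
(* Parallelogram law: 2|a phi|^2 + 2|psi|^2 exceeds |a phi + psi|^2 by |a phi - psi|^2. *)
rewrite -subr_ge0 [X in 0 <= X](_ : _ =
  (x * p - y * q - r) ^+ 2 + (x * q + y * p - s) ^+ 2); last by ring.
by rewrite addr_ge0 ?sqr_ge0.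
Qed.

(** A complex scalar cannot leave the real form, so it crosses to the other argument as its
    conjugate. This matches [rdotZl], which makes the two comparable in [synthesis_lin]. *)
Lemma rip_linl a phi psi chi D :
  square_integrable mu phi -> square_integrable mu psi ->
  square_integrable mu chi -> measurable D ->
  rip D (fun w => a * phi w + psi w) chi =
  rip D phi (fun w => (a^*)%C * chi w) + rip D psi chi.
Proof.
move=> p q r mD; rewrite /rip -RintegralD//; last exact: integrable_Re_mulJ.
  by apply: eq_Rintegral => w _; rewrite mulrDl cReD rmorphM/= conjcK mulrCA mulrA.
apply: integrable_Re_mulJ => //; under eq_fun do rewrite -[_ * _]addr0.
exact: square_integrable_lin r square_integrable0.
Qed.

Lemma rip_sqr_le phi psi D :
  square_integrable mu phi -> square_integrable mu psi -> measurable D ->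
  rip D phi psi ^+ 2 <= rip D phi phi * rip D psi psi.
Proof.
move=> p q mD; apply: sqr_le_mul_of_quadratic_ge0 => x y.
(* The quadratic form is the integral of |x phi - y psi|^2. *)
have -> : x ^+ 2 * rip D phi phi - 2 * (x * y * rip D phi psi)
    + y ^+ 2 * rip D psi psi =
  \int[mu]_(w in D) (complex.Re ((x%:C%C * phi w - y%:C%C * psi w) *
    ((x%:C%C * phi w - y%:C%C * psi w)^*)%C)); last first.
  by apply: Rintegral_ge0 => w _; exact: Re_mulJ_ge0.
have i1 := integrable_Re_mulJ p p mD; have i2 := integrable_Re_mulJ p q mD.
have i3 := integrable_Re_mulJ q q mD.
rewrite mulrA -!RintegralZl//.
rewrite -RintegralB ?integrableZl//; first last.
- exact: (integrableZl mD _ i2).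
- exact: (integrableZl mD _ i1).
rewrite -RintegralD//; first last.
- exact: (integrableZl mD _ i3).
- exact: (integrableB mD (integrableZl mD _ i1) (integrableZl mD _ i2)).
apply: eq_Rintegral => w _; rewrite !(cReM, cImM, cReJ, cImJ, cReB, cImB)/=; ring.
Qed.

Lemma rip_le_setT phi D : square_integrable mu phi -> measurable D ->
  rip D phi phi <= rip setT phi phi.
Proof.
move=> p mD; apply: fine_le.
- exact/integrable_fin_num/integrable_Re_mulJ.
- exact/integrable_fin_num/integrable_Re_mulJ.
apply: ge0_subset_integral => //.
- exact: measurable_int (integrable_Re_mulJ p p measurableT).
- by move=> w _; rewrite lee_fin Re_mulJ_ge0.
Qed.

Lemma rip_norm_le phi psi D :
  square_integrable mu phi -> square_integrable mu psi -> measurable D ->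
  `|rip D phi psi| <= L2norm mu D phi * L2norm mu D psi.
Proof.
move=> p q mD; rewrite !L2normE -sqrtrM ?rip_ge0// -sqrtr_sqr.
by rewrite ler_sqrt ?sqr_ge0 ?mulr_ge0 ?rip_ge0// rip_sqr_le.
Qed.

Lemma L2norm_eq0_ae phi : square_integrable mu phi ->
  L2norm mu setT phi = 0 -> {ae mu, forall w, phi w = 0}.
Proof.
move=> /square_integrableP[mphi iphi]; rewrite L2normE => /eqP.
rewrite sqrtr_eq0 => r0.
have {}r0 : rip setT phi phi = 0 by apply/eqP; rewrite eq_le r0 rip_ge0.
have : (\int[mu]_w `|(complex.Re (phi w * ((phi w)^*)%C))%:E| = 0)%E.
  rewrite -[RHS]/(0%:E) -r0 /rip /Rintegral fineK; last exact: integrable_fin_num.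
  by apply: eq_integral => w _; rewrite gee0_abs// lee_fin Re_mulJ_ge0.
move/ae_eq_integral_abs => /(_ measurableT (measurable_int _ iphi)).
by apply: filterS => w /(_ I) /= [] /Re_mulJ_eq0.
Qed.

(** The Riesz inequalities are given on sets of finite measure only, and [mu] need not be
    sigma-finite. For [phi] in L^2 these sets have finite measure, and they increase to the set
    where [phi] is nonzero. *)
Definition level phi n : set T :=
  [set w | n.+1%:R^-1 <= complex.Re (phi w * ((phi w)^*)%C)].

Lemma measurable_level phi n : cmeasurable_fun phi -> measurable (level phi n).
Proof.
move=> mphi; rewrite -[level _ _]setTI.
exact: measurable_fun_le (measurable_cst _) (measurable_Re_mulJ mphi mphi).
Qed.

(** Markov's inequality for |phi|^2. *)
Lemma level_fin phi n : square_integrable mu phi -> (mu (level phi n) < +oo)%E.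
Proof.
move=> /square_integrableP[mphi iphi].
have /integrableP[_ foo] := iphi.
have e0 : 0 < n.+1%:R^-1 :> R by rewrite invr_gt0 ltr0n.
have := @le_integral_comp_abse _ _ _ mu setT measurableT
  (fun w => (complex.Re (phi w * ((phi w)^*)%C))%:E) n.+1%:R^-1 id
  (@measurable_id _ _ _) (fun _ => id) (fun x y _ _ => id)
  (measurable_int _ iphi) e0.
rewrite setTI => /le_lt_trans/(_ foo).
rewrite -lte_pdivlMl// => /lt_le_trans h.
rewrite (_ : level phi n = [set w |
    (n.+1%:R^-1%:E <= `|(complex.Re (phi w * ((phi w)^*)%C))%:E|)%E]).
  exact: h (leey _).
by apply/seteqP; split=> w; rewrite /level /= lee_fin ger0_norm// Re_mulJ_ge0.
Qed.

Lemma nondecreasing_level phi n m : (n <= m)%N -> level phi n `<=` level phi m.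
Proof.
move=> nm w /=; apply: le_trans.
by rewrite lef_pV2 ?posrE ?ltr0n// ler_nat.
Qed.

Lemma level_near phi w : phi w <> 0 -> \forall n \near \oo, level phi n w.
Proof.
move=> phi0; have e0 : 0 < complex.Re (phi w * ((phi w)^*)%C).
  by rewrite lt_neqAle Re_mulJ_ge0 andbT eq_sym; apply/eqP => /Re_mulJ_eq0.
by near=> n; apply/ltW; near: n; exact: (near_infty_natSinv_lt (PosNum e0)).
Unshelve. all: end_near. Qed.

(** Dominated convergence: a point where [phi] is nonzero lies in all late levels, and elsewhere the
    integrand vanishes anyway. *)
Lemma cvg_rip_level phi psi :
  square_integrable mu phi -> square_integrable mu psi ->
  rip (level phi n) phi psi @[n --> \oo] --> rip setT phi psi.
Proof.
move=> p q; have i := integrable_Re_mulJ p q measurableT.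
have ml n : measurable (level phi n) by apply: measurable_level; case: p.
pose g w := (complex.Re (phi w * ((psi w)^*)%C))%:E.
have mg := measurable_int _ i.
have [] := @dominated_convergence _ _ _ mu setT measurableT
  (fun n => g \_ (level phi n)) g (fun w => `|g w|)%E.
- by move=> n; apply/measurable_restrict => //; exact: measurable_funS mg.
- exact: mg.
- apply: aeW => w _; have [phi0|phi0] := pselect (phi w = 0).
    rewrite (_ : (fun _ => _) = cst (g w)); first exact: cvg_cst.
    by apply/funext => n; rewrite patchE /g phi0 mul0r if_same.
  apply: cvg_near_cst; apply: filterS (level_near phi0) => n nw.
  by rewrite patchE mem_set.
- exact: integrable_abse i.
- by apply: aeW => w n _; rewrite patchE; case: ifP => // _; rewrite abse0 abse_ge0.
move=> _ _ h; apply: fine_cvg; rewrite fineK; last exact: integrable_fin_num i.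
by under eq_fun do rewrite integral_mkcond; exact: h.
Qed.

End SquareIntegrable.

(** * Analysis, synthesis and weak integrals tested on real parts *)

Section WeakIntegral.
Context (R : realType) (H : completeNormedModType R[i]).
Variable dot : {dot H for @Num.conj R[i]}.
Hypothesis Hdot : induces_norm dot.
Context (d : measure_display) (T : measurableType d).
Variable mu : {measure set T -> \bar R}.
Variable F : T -> H.
Implicit Types (D : set T) (phi psi : T -> R[i]) (f g v : H).

Definition analysis f : T -> R[i] := fun w => dot f (F w).

Definition synthesis phi : H := weak_integral mu dot setT phi F.

Lemma analysis_lin (a : R[i]) f g :
  analysis (a *: f + g) = fun w => a * analysis f w + analysis g w.
Proof. by apply/funext => w; rewrite /analysis dotDl dotZl. Qed.

Lemma analysisZ (a : R[i]) f : analysis (a *: f) = fun w => a * analysis f w.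
Proof. by apply/funext => w; rewrite /analysis dotZl. Qed.

Hypothesis F_L2 : L2H mu dot F.

Lemma analysis_L2 f : square_integrable mu (analysis f).
Proof. exact: F_L2. Qed.

(** The imaginary part of the integrand at f is its real part at if, so real identities for all f
    give the complex ones. Integrability is automatic for products of L^2 functions. *)
Lemma is_weak_integralP D phi v :
  square_integrable mu phi -> measurable D ->
  is_weak_integral mu dot D phi F v <->
  forall f, rdot dot v f = rip mu D phi (analysis f).
Proof.
move=> phi2 mD.
have ImE f w : complex.Im (phi w * dot (F w) f) =
    complex.Re (phi w * ((analysis ('i%C *: f) w)^*)%C).
  rewrite (dotC dot (F w)) analysisZ /analysis !(cReM, cImM, cReJ, cImJ)/=; ring.
have ReE f w : complex.Re (phi w * dot (F w) f) =
    complex.Re (phi w * ((analysis f w)^*)%C).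
  by rewrite (dotC dot (F w)).
have cintE f : cintegral mu D (fun w => phi w * dot (F w) f) =
    (Complex (rip mu D phi (analysis f)) (rip mu D phi (analysis ('i%C *: f)))).
  by congr Complex; apply: eq_Rintegral => w _.
split=> [h f|h f].
  by have [_] := h f; rewrite /rdot cintE => ->.
split; last first.
  rewrite cintE -!h -Im_dot /rdot.
  by case: (dot v f).
split; [under eq_fun do rewrite ReE|under eq_fun do rewrite ImE];
  exact: integrable_Re_mulJ (analysis_L2 _) mD.
Qed.

Lemma weak_integral_rdot D phi f :
  square_integrable mu phi -> measurable D ->
  (exists v, is_weak_integral mu dot D phi F v) ->
  rdot dot (weak_integral mu dot D phi F) f = rip mu D phi (analysis f).
Proof.
move=> phi2 mD /(@xgetPex _ 0) h.
by move/(is_weak_integralP _ phi2 mD) : h; apply.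
Qed.

End WeakIntegral.

(** * The synthesis map of a Riesz basis on all of L^2 *)

Section RieszBasis.
Context (R : realType) (H : completeNormedModType R[i]).
Variable dot : {dot H for @Num.conj R[i]}.
Hypothesis Hdot : induces_norm dot.
Context (d : measure_display) (T : measurableType d).
Variable mu : {measure set T -> \bar R}.
Variable F : T -> H.
Hypothesis HF : continuous_riesz_basis mu dot F.
Implicit Types (D : set T) (phi psi : T -> R[i]) (f g v : H).

Local Notation analysis := (analysis dot F).
Local Notation synthesis := (synthesis dot mu F).
Local Notation L2norm := (L2norm mu setT).

Let F_L2 : L2H mu dot F. Proof. by case: HF. Qed.

Lemma riesz_bounds : exists A B : R, [/\ 0 < A, 0 < B & forall phi D,
  square_integrable mu phi -> measurable D -> (mu D < +oo)%E ->
  A * Defs.L2norm mu D phi <= rnorm (weak_integral mu dot D phi F) <=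
  B * Defs.L2norm mu D phi].
Proof.
case: HF => _ _ [A [B [A0 B0 AB]]]; exists A, B; split=> // phi D p mD foo.
by have := AB phi D p mD foo; rewrite rnormE !lecR.
Qed.

(* If the weak integral did not exist, it would be the junk value [0], and the
   lower Riesz bound would force [phi] to vanish on [D]. *)
Lemma weak_integral_finE D phi f :
  square_integrable mu phi -> measurable D -> (mu D < +oo)%E ->
  rdot dot (weak_integral mu dot D phi F) f = rip mu D phi (analysis f).
Proof.
move=> p mD foo; apply: weak_integral_rdot => //.
apply: contrapT => nex.
have [A [B [A0 B0 AB]]] := riesz_bounds.
have /andP[+ _] := AB phi D p mD foo.
have -> : weak_integral mu dot D phi F = 0.
  by apply: xgetPN => v hv; apply: nex; exists v.
rewrite rnorm0 pmulr_rle0// => n0.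
apply: nex; exists 0; apply/(is_weak_integralP F_L2 _ p mD) => // g.
have n0' : Defs.L2norm mu D phi = 0 by apply/eqP; rewrite eq_le n0 sqrtr_ge0.
have := rip_norm_le p (F_L2 g) mD; rewrite n0' mul0r normr_le0 => /eqP ->.
by rewrite /rdot linear0l.
Qed.

(** The integrals over the levels form a Cauchy sequence, by the upper Riesz bound on differences of
    levels, and their limit is the weak integral over the whole space. Convergence of the norms is
    kept for [synthesis_bounds]. *)
Lemma cvg_weak_integral_level phi : square_integrable mu phi ->
  exists v, [/\ is_weak_integral mu dot setT phi F v &
   rnorm (weak_integral mu dot (level phi n) phi F) @[n --> \oo] --> rnorm v].
Proof.
move=> p; have ml n := measurable_level n p.1; have fl n := level_fin n p.
have [A [B [A0 B0 AB]]] := riesz_bounds.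
pose u n := weak_integral mu dot (level phi n) phi F.
have uE n f : rdot dot (u n) f = rip mu (level phi n) phi (analysis f).
  exact: weak_integral_finE.
have ripB n m psi : (n <= m)%N -> square_integrable mu psi ->
  rip mu (level phi m `\` level phi n) phi psi =
  rip mu (level phi m) phi psi - rip mu (level phi n) phi psi.
  move=> nm q; apply/eqP; rewrite eq_sym subr_eq eq_sym addrC; apply/eqP.
  rewrite /rip -Rintegral_setU//.
  - by rewrite setDUK//; exact: nondecreasing_level.
  - exact: measurableD.
  - by rewrite setDUK; [exact: integrable_Re_mulJ|exact: nondecreasing_level].
  - by apply/disj_setPS; rewrite setDIK.
have mD n m : measurable (level phi m `\` level phi n) by exact: measurableD.
have fD n m : (mu (level phi m `\` level phi n) < +oo)%E.
  apply: le_lt_trans (fl m); apply: le_measure; rewrite ?inE//.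
have uB n m : (n <= m)%N -> u m - u n =
    weak_integral mu dot (level phi m `\` level phi n) phi F.
  move=> nm; apply: (rdot_ext Hdot) => f.
  by rewrite (rdotBl dot) !uE weak_integral_finE// ripB//; exact: analysis_L2.
(* The upper Riesz bound [B] times the L^2 norm of [phi] off the n-th level. *)
pose e n := B * Num.sqrt (rip mu setT phi phi - rip mu (level phi n) phi phi).
have ue n m : (n <= m)%N -> rnorm (u m - u n) <= e n.
  move=> nm; rewrite uB//.
  have /andP[_ /le_trans->//] := AB _ _ p (mD n m) (fD n m).
  rewrite L2normE /e ripB// ler_wpM2l ?(ltW B0)// ler_wsqrtr// lerB//.
  exact: rip_le_setT.
have e0 : e @ \oo --> 0.
  rewrite -(mulr0 B) -sqrtr0 -(subrr (rip mu setT phi phi)).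
  apply: cvgMr; apply: (@continuous_cvg _ _ _ _ _ _ (@Num.sqrt R)).
    exact: sqrt_continuous.
  by apply: cvgB; [exact: cvg_cst|exact: cvg_rip_level].
have [v uv] := rnorm_complete ue e0.
exists v; split; last exact: cvg_rnorm.
apply/(is_weak_integralP F_L2 _ p measurableT) => f.
(* Both sides are limits of the same sequence, the identity being known on each level. *)
rewrite -(cvg_lim _ (@cvg_rdotl _ _ _ Hdot _ _ f uv))//; apply: cvg_lim => //.
by under eq_fun do rewrite uE; apply: cvg_rip_level p _; exact: analysis_L2.
Qed.

(** Adjointness of T_F and T_F^* in real form; existence of the weak integral excludes the default
    value 0. *)
Lemma synthesis_rdot phi f : square_integrable mu phi ->
  rdot dot (synthesis phi) f = rip mu setT phi (analysis f).
Proof.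
move=> p; have [v [hv _]] := cvg_weak_integral_level p.
by apply: weak_integral_rdot => //; exists v.
Qed.

Lemma synthesis_lin (a : R[i]) phi psi :
  square_integrable mu phi -> square_integrable mu psi ->
  synthesis (fun w => a * phi w + psi w) = a *: synthesis phi + synthesis psi.
Proof.
move=> p q; apply: (rdot_ext Hdot) => f.
rewrite synthesis_rdot; last exact: square_integrable_lin.
rewrite rip_linl//; last exact: analysis_L2.
by rewrite -analysisZ (rdotDl dot) rdotZl !synthesis_rdot.
Qed.

(** The Riesz inequalities hold on each level, and both norms converge along the levels. *)
Lemma synthesis_bounds : exists A B : R, [/\ 0 < A, 0 < B & forall phi,
  square_integrable mu phi ->
  A * L2norm phi <= rnorm (synthesis phi) <= B * L2norm phi].
Proof.
have [A [B [A0 B0 AB]]] := riesz_bounds; exists A, B; split=> // phi p.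
have [v [hv uv]] := cvg_weak_integral_level p.
have -> : synthesis phi = v.
  apply: (rdot_ext Hdot) => f; rewrite synthesis_rdot//.
  by move/(is_weak_integralP F_L2 _ p measurableT) : hv => ->.
have nl : Defs.L2norm mu (level phi n) phi @[n --> \oo] --> L2norm phi.
  under eq_fun do rewrite L2normE; rewrite L2normE.
  apply: (@continuous_cvg _ _ _ _ _ _ (@Num.sqrt R)); first exact: sqrt_continuous.
  exact: cvg_rip_level.
have ABn n := AB phi _ p (measurable_level n p.1) (level_fin n p).
apply/andP; split.
  apply: (ler_cvg_to (cvgMr nl) uv); apply: nearW => n.
  by have /andP[] := ABn n.
apply: (ler_cvg_to uv (cvgMr nl)); apply: nearW => n.
by have /andP[] := ABn n.
Qed.

End RieszBasis.

(** * Invertibility of bounded coercive operators *)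

Section LaxMilgram.
Context (R : realType) (H : completeNormedModType R[i]).
Variable dot : {dot H for @Num.conj R[i]}.
Hypothesis Hdot : induces_norm dot.
Variables (U : H -> H) (a b : R).
Hypotheses (linU : linear U) (a_gt0 : 0 < a).
Hypothesis coercU : forall x, a * rnorm x ^+ 2 <= rdot dot (U x) x.
Hypothesis boundU : forall x, rnorm (U x) <= b * rnorm x.

Let UB x y : U (x - y) = U x - U y.
Proof. by rewrite addrC -scaleN1r linU scaleN1r addrC. Qed.

Lemma coercive_rnorm_le x : a * rnorm x <= rnorm (U x).
Proof.
have [x0|x0] := eqVneq (rnorm x) 0; first by rewrite x0 mulr0 rnorm_ge0.
have x_gt0 : 0 < rnorm x by rewrite lt_neqAle eq_sym x0 rnorm_ge0.
rewrite -(ler_pM2r x_gt0) -mulrA -expr2.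
exact: le_trans (coercU x) (rdot_le Hdot _ _).
Qed.

Lemma coercive_inj x y : U x = U y -> x = y.
Proof.
move=> xy; apply/eqP; rewrite -subr_eq0; apply/eqP/rnorm_eq0/eqP.
rewrite eq_le rnorm_ge0 andbT -(pmulr_rle0 _ a_gt0).
by apply: le_trans (coercive_rnorm_le _) _; rewrite UB xy subrr rnorm0.
Qed.

(* For small [c], [x |-> x + c (v - U x)] is a contraction, whose fixed point is
   a preimage of [v]. *)
Lemma coercive_surj v : exists x, U x = v.
Proof.
(* A bound for [U] that is positive and at least [a], so that 1 - (a / B)^2 is nonnegative. *)
pose B := a + `|b|; have B_gt0 : 0 < B by rewrite ltr_pwDl.
have aB : a <= B by rewrite lerDl.
(* This [c] minimizes 1 - 2ca + c^2 B^2, the bound for the squared contraction factor; the minimum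
   is q^2. *)
pose c := a / B ^+ 2; have c_gt0 : 0 < c by rewrite divr_gt0// exprn_gt0.
pose q := Num.sqrt (1 - (a / B) ^+ 2).
have aB2 : 0 < (a / B) ^+ 2 by rewrite exprn_gt0// divr_gt0.
have aB2_le1 : (a / B) ^+ 2 <= 1.
  by rewrite expr_le1 ?ler_pdivrMr ?mul1r// divr_ge0// ltW.
have q_lt1 : q < 1 by rewrite -[ltRHS]sqrtr1 ltr_sqrt// ltrBlDr ltrDl.
have q_ge0 : 0 <= q by exact: sqrtr_ge0.
have contr z : rnorm (z - c%:C%C *: U z) <= q * rnorm z.
  rewrite -ler_sqr ?nnegrE ?mulr_ge0 ?rnorm_ge0// exprMn sqr_sqrtr ?subr_ge0//.
  rewrite (rnorm_sqrB Hdot) rnormZ exprMn real_normK ?num_real// (rdotC dot) rdotZrl.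
  have h1 := coercU z.
  have h2 : rnorm (U z) ^+ 2 <= B ^+ 2 * rnorm z ^+ 2.
    rewrite -exprMn ler_sqr ?nnegrE ?mulr_ge0 ?rnorm_ge0 ?(ltW B_gt0)//.
    apply: le_trans (boundU z) _; rewrite ler_wpM2r ?rnorm_ge0//.
    by rewrite (le_trans (ler_norm _))// lerDr ltW.
  have h3 : 2 * c * (a * rnorm z ^+ 2) <= 2 * c * rdot dot (U z) z.
    by rewrite ler_wpM2l// mulr_ge0// ltW.
  have h4 : c ^+ 2 * rnorm (U z) ^+ 2 <= c ^+ 2 * (B ^+ 2 * rnorm z ^+ 2).
    by rewrite ler_wpM2l// sqr_ge0.
  have -> : (1 - (a / B) ^+ 2) * rnorm z ^+ 2 = rnorm z ^+ 2 -
      2 * c * (a * rnorm z ^+ 2) + c ^+ 2 * (B ^+ 2 * rnorm z ^+ 2).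
    by rewrite /c; field; rewrite gt_eqF.
  by rewrite mulrA; lra.
pose step x := x + c%:C%C *: (v - U x).
have stepB x y : rnorm (step x - step y) <= q * rnorm (x - y).
  rewrite (_ : step x - step y = (x - y) - c%:C%C *: U (x - y)) ?contr//.
  by rewrite /step UB !scalerBr opprD addrACA !opprB;
    congr (_ + _); rewrite addrC addrA subrK.
pose y n := iter n step 0.
pose D := rnorm (y 1%N - y 0%N).
have yS n : rnorm (y n.+1 - y n) <= q ^+ n * D.
  elim: n => [|n ih]; first by rewrite expr0 mul1r.
  by rewrite exprS -mulrA (le_trans (stepB _ _))// ler_wpM2l.
have q1 : 0 < 1 - q by rewrite subr_gt0.
(* Keeping the exact geometric sum on the right makes the induction step an equality of bounds. *)
have yD n m : rnorm (y (n + m)%N - y n) <= D / (1 - q) * (q ^+ n - q ^+ (n + m)).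
  elim: m => [|m ih]; first by rewrite addn0 !subrr rnorm0 mulr0.
  rewrite addnS -(subrK (y (n + m)%N) (y _)) -addrA (le_trans (ler_rnormD _ _))//.
  have := lerD (yS (n + m)%N) ih; move/le_trans; apply.
  by rewrite exprS le_eqVlt; apply/orP; left; apply/eqP; field; rewrite gt_eqF.
pose e n := D / (1 - q) * q ^+ n.
have ye n m : (n <= m)%N -> rnorm (y m - y n) <= e n.
  move=> nm; rewrite -(subnKC nm) (le_trans (yD _ _))// ler_wpM2l//.
    by rewrite divr_ge0 ?rnorm_ge0// ltW.
  by rewrite gerBl exprn_ge0.
have qn0 : q ^+ n @[n --> \oo] --> (0 : R).
  by apply: cvg_expr; rewrite ger0_norm.
have e0 : e @ \oo --> 0 by rewrite -(mulr0 (D / (1 - q))); apply: cvgMr.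
have [x yx] := rnorm_complete ye e0.
exists x; apply/esym/eqP; rewrite -subr_eq0; apply/eqP/rnorm_eq0/eqP.
rewrite eq_le rnorm_ge0 andbT -(pmulr_rle0 _ c_gt0).
(* This null sequence dominates c |v - U x|: split off c (v - U (y n)), which is [y n.+1 - y n],
   from c U (y n - x). *)
have lim0 : q ^+ n * D + c * (`|b| * rnorm (y n - x)) @[n --> \oo] -->
    0 * D + c * (`|b| * 0).
  apply: cvgD; first exact: cvgMl.
  by apply: cvgMr; apply: cvgMr.
rewrite mul0r !mulr0 addr0 in lim0.
apply: (ler_cvg_to (cvg_cst _) lim0); apply: nearW => n.
rewrite -(subrK (U (y n)) v) -addrA -UB.
rewrite (le_trans (ler_wpM2l (ltW c_gt0) (ler_rnormD _ _)))// mulrDr lerD//.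
  apply: le_trans (yS n); rewrite /y iterS -/(y n) /step addrAC subrr add0r.
  by rewrite rnormZ gtr0_norm.
rewrite ler_wpM2l ?(ltW c_gt0)// (le_trans (boundU _))// ler_wpM2r ?rnorm_ge0//.
exact: ler_norm.
Qed.

Lemma coercive_inverse : exists V : H -> H,
  [/\ cancel U V, cancel V U, linear V & forall x, rnorm (V x) <= a^-1 * rnorm x].
Proof.
have [V VK] := choice coercive_surj.
have UK : cancel U V by move=> x; apply: coercive_inj; rewrite VK.
exists V; split=> // [k x y|x].
  by apply: coercive_inj; rewrite linU !VK.
by rewrite ler_pdivlMl// -{2}(VK x) coercive_rnorm_le.
Qed.

End LaxMilgram.

(** * Frame bounds and the inverse frame operator *)

Section RieszFrame.
Context (R : realType) (H : completeNormedModType R[i]).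
Variable dot : {dot H for @Num.conj R[i]}.
Hypothesis Hdot : induces_norm dot.
Context (d : measure_display) (T : measurableType d).
Variable mu : {measure set T -> \bar R}.
Variable F : T -> H.
Hypothesis HF : continuous_riesz_basis mu dot F.
Implicit Types (phi psi : T -> R[i]) (f g v : H).

Local Notation analysis := (analysis dot F).
Local Notation synthesis := (synthesis dot mu F).
Local Notation L2norm := (L2norm mu setT).
Local Notation S := (frame_operator mu dot F).

Let F_L2 : L2H mu dot F. Proof. by case: HF. Qed.
Let an2 f : square_integrable mu (analysis f). Proof. exact: analysis_L2. Qed.

Lemma L2norm_sqr phi : L2norm phi ^+ 2 = rip mu setT phi phi.
Proof. by rewrite L2normE sqr_sqrtr// rip_ge0. Qed.

Lemma frame_rdot f g : rdot dot (S f) g = rip mu setT (analysis f) (analysis g).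
Proof. exact: (synthesis_rdot Hdot HF). Qed.

(** T_F^* inherits the constants of T_F. The upper bound follows from |T_F^* f|^2 = <T_F T_F^* f,
    f>. For the lower one, f is approximated by some T_F phi, and <T_F phi, f> = <phi, T_F^* f> with
    A |phi| at most |T_F phi|. *)
Lemma analysis_bounds : exists A B : R, [/\ 0 < A, 0 < B & forall f,
  A * rnorm f <= L2norm (analysis f) <= B * rnorm f].
Proof.
have [A [B [A0 B0 AB]]] := synthesis_bounds Hdot HF.
exists A, B; split=> // f; apply/andP; split; last first.
  have [n0|n0] := eqVneq (L2norm (analysis f)) 0.
    by rewrite n0 mulr_ge0 ?rnorm_ge0// ltW.
  have n_gt0 : 0 < L2norm (analysis f) by rewrite lt_neqAle eq_sym n0 L2norm_ge0.
  rewrite -(ler_pM2l n_gt0) -expr2 L2norm_sqr -(synthesis_rdot Hdot HF)//.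
  apply: le_trans (rdot_le Hdot _ _) _.
  rewrite mulrCA mulrA ler_wpM2r ?rnorm_ge0//.
  by case/andP: (AB _ (an2 f)).
set s := L2norm (analysis f).
have s0 : 0 <= s := L2norm_ge0 _ _ _.
(* The lower bound times |f|, with the error caused by approximating f within e. *)
have approx e : 0 < e -> A * rnorm f ^+ 2 <= rnorm f * s + e * (s + A * rnorm f).
  move=> e0.
  have [_ dF _] := HF.
  have [|v [fv [phi p pv]]] := dF (ball f e%:C%C) _ (ball_open _ _).
    by exists f; apply: ballxx; rewrite ltcR.
  have {}fv : rnorm (f - v) < e.
    by move: fv; rewrite -ball_normE /= rnormE ltcR.
  have pvE : synthesis phi = v by [].
  have /andP[h1 _] := AB _ p.
  have h2 : rdot dot v f <= L2norm phi * s.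
    rewrite -pvE (synthesis_rdot Hdot HF)//.
    exact: le_trans (ler_norm _) (rip_norm_le p (an2 f) measurableT).
  have h3 : rnorm f ^+ 2 <= rdot dot v f + e * rnorm f.
    rewrite -(rdotxx Hdot) -{1}(subrK v f) (rdotDl dot) addrC lerD2l.
    apply: le_trans (rdot_le Hdot _ _) _; rewrite ler_wpM2r ?rnorm_ge0//.
    exact: ltW.
  have h4 : A * L2norm phi <= rnorm f + e.
    apply: le_trans h1 _.
    rewrite pvE -(subrK f v) addrC (le_trans (ler_rnormD _ _))//.
    by rewrite lerD2l rnormB ltW.
  have h5 : A * (L2norm phi * s) <= (rnorm f + e) * s.
    by rewrite mulrA ler_wpM2r.
  have h6 : A * rnorm f ^+ 2 <= A * (L2norm phi * s + e * rnorm f).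
    by rewrite ler_wpM2l ?(ltW A0)//; lra.
  by lra.
have [f0|f0] := eqVneq (rnorm f) 0; first by rewrite f0 mulr0.
have f_gt0 : 0 < rnorm f by rewrite lt_neqAle eq_sym f0 rnorm_ge0.
rewrite -(ler_pM2l f_gt0) mulrCA -expr2.
apply/ler_addgt0Pr => e e0.
(* Approximating within e / (s + A |f|) makes the error exactly e. *)
have k_gt0 : 0 < s + A * rnorm f by rewrite ltr_wpDl// mulr_gt0.
by have := approx _ (divr_gt0 e0 k_gt0); rewrite divfK// gt_eqF.
Qed.

Lemma frame_linear : linear S.
Proof.
by move=> a f g; rewrite -synthesis_lin// -analysis_lin.
Qed.

(** Since <S f, f> = |T_F^* f|^2, the lower analysis bound [A] makes [S] coercive with constant
    A^2. *)
Lemma frame_inverse : exists (V : H -> H) (C : R),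
  [/\ cancel S V, cancel V S, linear V & forall x, rnorm (V x) <= C * rnorm x].
Proof.
have [A [B [A0 B0 AB]]] := analysis_bounds.
have [A' [B' [_ B'0 AB']]] := synthesis_bounds Hdot HF.
have A2 : 0 < A ^+ 2 by rewrite exprn_gt0.
have [||V [h1 h2 h3 h4]] :=
  @coercive_inverse _ _ _ Hdot S _ (B' * B) frame_linear A2.
- move=> f; rewrite frame_rdot -L2norm_sqr -exprMn.
  rewrite ler_sqr ?nnegrE ?L2norm_ge0 ?mulr_ge0 ?rnorm_ge0 ?(ltW A0)//.
  by case/andP: (AB f).
- move=> f; have /andP[_ /le_trans->//] := AB' _ (an2 f).
  by rewrite -mulrA ler_wpM2l ?(ltW B'0)//; case/andP: (AB f).
by exists V, (A ^+ 2)^-1.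
Qed.

(** As S h = T_F T_F^* h, the hypothesis says that T_F kills T_F^* h - phi, which is then null by
    the lower Riesz bound. *)
Lemma analysis_ae_of_frame phi h : square_integrable mu phi ->
  S h = synthesis phi -> {ae mu, forall w, analysis h w = phi w}.
Proof.
move=> p hp; have [A [B [A0 B0 AB]]] := synthesis_bounds Hdot HF.
have q := square_integrable_lin (-1) p (an2 h).
have : L2norm (fun w => -1 * phi w + analysis h w) = 0.
  apply/eqP; rewrite eq_le L2norm_ge0 andbT -(pmulr_rle0 _ A0).
  have /andP[/le_trans+ _] := AB _ q; apply.
  rewrite synthesis_lin// -hp scaleN1r addrC subrr rnorm0//.
move=> /(L2norm_eq0_ae q); apply: filterS => w.
by rewrite mulN1r addrC => /eqP; rewrite subr_eq0 => /eqP.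
Qed.

End RieszFrame.

(** * Operators mixing two Riesz bases *)

Section MixedFrame.
Context (R : realType) (H : completeNormedModType R[i]).
Variable dot : {dot H for @Num.conj R[i]}.
Hypothesis Hdot : induces_norm dot.
Context (d : measure_display) (T : measurableType d).
Variable mu : {measure set T -> \bar R}.
Implicit Types F G : T -> H.

(** The operator T_F T_G^*, which for F = G is the frame operator. *)
Definition mixed_frame F G f := synthesis dot mu F (analysis dot G f).

Section Basics.
Variables F G : T -> H.
Hypothesis HF : continuous_riesz_basis mu dot F.
Hypothesis HG : continuous_riesz_basis mu dot G.

Let anF f : square_integrable mu (analysis dot F f).
Proof. by apply: analysis_L2; case: HF. Qed.

Let anG f : square_integrable mu (analysis dot G f).
Proof. by apply: analysis_L2; case: HG. Qed.

Lemma mixed_frame_linear : linear (mixed_frame F G).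
Proof.
by move=> a f g; rewrite /mixed_frame -(synthesis_lin Hdot HF)// -analysis_lin.
Qed.

(** Both sides are the real L^2 product of T_G^* f and T_F^* g. *)
Lemma mixed_frame_adjoint f g :
  rdot dot (mixed_frame F G f) g = rdot dot f (mixed_frame G F g).
Proof.
rewrite (rdotC dot f) /mixed_frame (synthesis_rdot Hdot HF)//.
by rewrite (synthesis_rdot Hdot HG)// ripC.
Qed.

Lemma mixed_frame_bounded :
  exists2 C, 0 <= C & forall f, rnorm (mixed_frame F G f) <= C * rnorm f.
Proof.
have [A [B [_ B0 AB]]] := synthesis_bounds Hdot HF.
have [A' [B' [_ B'0 AB']]] := analysis_bounds Hdot HG.
exists (B * B') => [|f]; first by rewrite mulr_ge0// ltW.
have /andP[_ /le_trans->//] := AB _ (anG f).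
by rewrite -mulrA ler_wpM2l ?(ltW B0)//; case/andP: (AB' f).
Qed.

(* [synthesis F] is onto, with kernel the null functions, so that
   [V (synthesis F phi)] is the vector whose analysis is [phi]. *)
Lemma analysis_frame_inverse_synthesis V phi :
  cancel V (frame_operator mu dot F) -> square_integrable mu phi ->
  {ae mu, forall w, analysis dot F (V (synthesis dot mu F phi)) w = phi w}.
Proof. by move=> VK p; apply: (analysis_ae_of_frame Hdot HF). Qed.

End Basics.

(** Allows the almost everywhere identities for analysis to be used under synthesis. *)
Lemma synthesis_ae F phi psi : continuous_riesz_basis mu dot F ->
  square_integrable mu phi -> square_integrable mu psi ->
  {ae mu, forall w, phi w = psi w} ->
  synthesis dot mu F phi = synthesis dot mu F psi.
Proof.
move=> HF p q pq; have F2 : L2H mu dot F by case: HF.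
apply: (rdot_ext Hdot) => f; rewrite !(synthesis_rdot Hdot HF)//.
congr fine; apply: ae_eq_integral => //.
- exact: measurable_int (integrable_Re_mulJ p (analysis_L2 F2 f) measurableT).
- exact: measurable_int (integrable_Re_mulJ q (analysis_L2 F2 f) measurableT).
by apply: filterS pq => w -> _.
Qed.

(** The inner factor T_F^* S_F^-1 T_F is the identity of L^2, which leaves T_G T_G^*. Used with both
    orders of the two bases, this gives the two cancellations for Theta. *)
Lemma mixed_frameK F G V f :
  continuous_riesz_basis mu dot F -> continuous_riesz_basis mu dot G ->
  cancel V (frame_operator mu dot F) ->
  mixed_frame G F (V (mixed_frame F G f)) = frame_operator mu dot G f.
Proof.
move=> HF HG VK; have [F2 _ _] := HF; have [G2 _ _] := HG.
apply: (synthesis_ae HG); [exact: analysis_L2|exact: analysis_L2|].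
exact: analysis_frame_inverse_synthesis VK (analysis_L2 G2 f).
Qed.

End MixedFrame.

Theorem theorem3p18 (R : realType) (H : completeNormedModType R[i])
    (dot : {dot H for @Num.conj R[i]}) (Hdot : induces_norm dot)
    (d : measure_display) (Omega : measurableType d)
    (mu : {measure set Omega -> \bar R}) (F G : Omega -> H)
    (HF : continuous_riesz_basis mu dot F)
    (HG : continuous_riesz_basis mu dot G) :
  exists (Theta : {linear H -> H}) (Thetas : H -> H),
    [/\ invertible_operator Theta,
        is_adjoint dot Theta Thetas &
        weakly_ae_eq mu dot G
          (fun w => frame_operator mu dot G (Thetas (F w)))].
Proof.
have [VF [CF [SVF VSF linF bF]]] := frame_inverse Hdot HF.
have [VG [CG [SVG VSG linG bG]]] := frame_inverse Hdot HG.
pose M := mixed_frame dot mu F G; pose Ms := mixed_frame dot mu G F.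
have linM : linear M := mixed_frame_linear Hdot HF HG.
have linMs : linear Ms := mixed_frame_linear Hdot HG HF.
have [C C0 bM] := mixed_frame_bounded Hdot HF HG.
have [Cs _ bMs] := mixed_frame_bounded Hdot HG HF.
(* [ths] composes the adjoints in reverse order, the inverse frame operators being self-adjoint. *)
pose th x := VF (M (VG x)); pose ths x := VG (Ms (VF x)).
have linth : linear th by move=> a x y; rewrite /th linG linM linF.
pose Theta : {linear H -> H} := HB.pack th (GRing.isLinear.Build _ _ _ _ th linth).
pose Psi : {linear H -> H} := HB.pack Ms (GRing.isLinear.Build _ _ _ _ Ms linMs).
(* Writing x = S V x and y = S V y turns both sides into the symmetric real product of the analyses
   of V x and V y. *)
have symV K V (HK : continuous_riesz_basis mu dot K)
    (VK : cancel V (frame_operator mu dot K)) x y :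
    rdot dot (V x) y = rdot dot x (V y).
  by rewrite -{1}(VK y) -{2}(VK x) (rdotC dot (V x)) !(frame_rdot Hdot HK) ripC.
(* Stated without the factor [VG], because S_G cancels that factor of [ths] in the final
   identity. *)
have VFM_adjoint : is_adjoint dot (VF \o M) (Ms \o VF).
  apply: rdot_adjoint => [a x y|x y] /=; first by rewrite linM linF.
  by rewrite (symV F VF)// mixed_frame_adjoint.
have VG_adjoint : is_adjoint dot VG VG.
  exact: rdot_adjoint linG (symV G VG HG VSG).
exists Theta, ths; split.
- split.
    (* Absolute values, as the signs of [CF] and [CG] are not given. *)
    apply: (@linear_rnorm_bounded_continuous _ _ _ (`|CF| * (C * `|CG|))) => x.
    have aux (V : H -> H) (K : R) z : (forall x, rnorm (V x) <= K * rnorm x) ->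
        rnorm (V z) <= `|K| * rnorm z.
      by move=> /(_ z) /le_trans; apply; rewrite ler_wpM2r ?rnorm_ge0// ler_norm.
    rewrite (le_trans (aux _ _ _ bF))// -mulrA ler_wpM2l//.
    by rewrite (le_trans (bM _))// -mulrA ler_wpM2l// aux.
  exists Psi; split.
  + exact: (@linear_rnorm_bounded_continuous _ _ Psi Cs).
  + by move=> x; rewrite /= /th /Ms (mixed_frameK Hdot _ HF HG)// VSG.
  + by move=> x; rewrite /= /th /M (mixed_frameK Hdot _ HG HF)// SVF.
- move=> x y; rewrite -[(Theta x)]/((VF \o M) (VG x)) VFM_adjoint.
  exact: VG_adjoint.
- move=> f; have G2 : L2H mu dot G by case: HG.
  (* Outside a null set depending on f, <f, G w> = <VF (M f), F w>; the adjoint then moves [VF] and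
     [M] onto F w. *)
  apply: filterS (analysis_frame_inverse_synthesis Hdot HF VSF (analysis_L2 G2 f)).
  move=> w; rewrite /analysis => <-.
  by rewrite /ths VSG; exact: VFM_adjoint.
Qed.
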